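(* Let $X$ be a compact metrizable space, let $T:X\to X$ be a homeomorphism, and let $d$ be a metric on $X$ compatible with the topology. For any positive number $\delta$, \[ \overline{\mathrm{mdim}}_M(X,T,d)=\limsup_{\varepsilon\to 0}\frac{\sup_{x\in X}S\left(B_\delta(x,d_{\mathbb{Z}}),\varepsilon\right)}{\log(1/\varepsilon)}, \] \[ \underline{\mathrm{mdim}}_M(X,T,d)=\liminf_{\varepsilon\to 0}\frac{\sup_{x\in X}S\left(B_\delta(x,d_{\mathbb{Z}}),\varepsilon\right)}{\log(1/\varepsilon)}. \]
   Context: Spanning numbers: for a metric $\rho$ on $X$, $\varepsilon>0$ and $K\subset X$, a subset $E\subset X$ is a $(\rho,\varepsilon)$-spanning set of $K$ if for every $x\in K$ there is $y\in E$ with $\rho(x,y)\le\varepsilon$ (points of $E$ need not lie in $K$). $\#(K,\rho,\varepsilon)$ denotes the minimum cardinality of such $E$. For $\Omega\subset\mathbb{Z}$ put $d_\Omega(x,y):=\sup_{a\in\Omega}d(T^ax,T^ay)$; in particular $d_{\mathbb{Z}}(x,y)=\sup_{n\in\mathbb{Z}}d(T^nx,T^ny)$. For a natural number $N$ put $d_N(x,y):=d_{\{0,1,\dots,N-1\}}(x,y)=\max_{0\le n<N}d(T^nx,T^ny)$. For $\varepsilon>0$ and $K\subset X$, the entropy of $K$ at the scale $\varepsilon$ is \[S(K,\varepsilon):=\limsup_{N\to\infty}\frac{\log\#(K,d_N,\varepsilon)}{N}.\] The upper and lower metric mean dimensions are \[\overline{\mathrm{mdim}}_M(X,T,d):=\limsup_{\varepsilon\to0}\frac{S(X,\varepsilon)}{\log(1/\varepsilon)},\qquad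 \underline{\mathrm{mdim}}_M(X,T,d):=\liminf_{\varepsilon\to0}\frac{S(X,\varepsilon)}{\log(1/\varepsilon)}.\] For $x\in X$, $\delta>0$ and $\Omega\subset\mathbb{Z}$, $B_\delta(x,d_\Omega):=\{y\in X\mid d_\Omega(x,y)\le\delta\}$ is the closed $\delta$-ball. Thus $B_\delta(x,d_{\mathbb{Z}})=\{y\in X\mid d(T^nx,T^ny)\le\delta\text{ for all }n\in\mathbb{Z}\}$. *)

(* Defs.v *)
From HB Require Import structures.
From mathcomp Require Import all_boot all_order all_algebra finmap.
From mathcomp Require Import all_classical all_reals all_analysis.

Set Implicit Arguments.
Unset Strict Implicit.
Unset Printing Implicit Defensive.

Import Order.TTheory GRing.Theory Num.Theory.
Import numFieldNormedType.Exports.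

Local Open Scope classical_set_scope.
Local Open Scope ring_scope.

Record homeomorphism (X : topologicalType) := Homeomorphism {
  homeo_fun :> X -> X;
  homeo_inv : X -> X;
  homeo_funK : cancel homeo_fun homeo_inv;
  homeo_invK : cancel homeo_inv homeo_fun;
  homeo_continuous : continuous homeo_fun;
  homeo_inv_continuous : continuous homeo_inv
}.

Definition homeo_iter (X : topologicalType) (T : homeomorphism X) (a : int) :
    X -> X :=
  match a with
  | Posz n => iter n T
  | Negz n => iter n.+1 (homeo_inv T)   (* Negz n is - n.+1 *)
  end.

Section SpanningNumber.
Context {R : realType} {X : choiceType}.
Implicit Types (K E : set X) (rho : X -> X -> R) (eps : R).

Definition spanning_set K rho eps E : Prop :=
  forall x, K x -> exists2 y, E y & rho x y <= eps.

(* The value is +oo when K has no finite spanning set, and is otherwise an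
   attained minimum. *)
Definition spanning_number K rho eps : \bar R :=
  ereal_inf [set (#|` E|%fset%:R : R)%:E |
             E in [set E : {fset X} | spanning_set K rho eps [set` E]]].

End SpanningNumber.

(* The metric d of a metricType is mdist; a metricType carries the topology
   induced by mdist. *)
Section MetricMeanDimension.
Context {R : realType} {X : metricType R}.
Implicit Types (T : homeomorphism X) (K : set X) (Omega : set int).
Implicit Types (x y : X) (eps delta : R) (N : nat).

(* A real supremum: sup is 0 by convention on an empty or unbounded set.  The
   set is bounded when X is compact. *)
Definition dist_on T Omega x y : R :=
  sup [set mdist (homeo_iter T a x) (homeo_iter T a y) | a in Omega].

Definition dist_upto T N : X -> X -> R :=
  dist_on T [set a : int | 0 <= a < N%:Z].

Definition closed_ball_on T Omega x delta : set X :=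
  [set y | dist_on T Omega x y <= delta].

(* lne 0 = -oo, so that the empty set has entropy -oo. *)
Definition entropy_at_scale T K eps : \bar R :=
  limn_esup (fun N : nat =>
    lne (spanning_number K (dist_upto T N) eps) / (N%:R : R)%:E)%E.

Definition upper_mdim T : \bar R :=
  limf_esup (fun eps : R =>
    entropy_at_scale T [set: X] eps / (ln (1 / eps))%:E)%E 0^'+.

Definition lower_mdim T : \bar R :=
  limf_einf (fun eps : R =>
    entropy_at_scale T [set: X] eps / (ln (1 / eps))%:E)%E 0^'+.

End MetricMeanDimension.

(* Main.v *)
(* Bowen's argument.  Let a(eps) be the supremum over x of
   S(B_delta(x, d_Z), eps) and let c > a(eps).  Around each x some window
   [0, m) of time has the closed ball B_delta(x, d_Z) covered by at most
   exp(c m) sets of d_m-diameter at most 4 eps.  By compactness this persists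
   for the balls B_delta(u, d_[-N, N]) with u near x, and N and the bound m <= N
   can be taken uniform over X.  Concatenating such windows along an orbit,
   B_delta(x, d_n) is covered by const * exp(c n) sets of d_n-diameter at most
   4 eps, uniformly in x, whence S(X, 4 eps) <= S(X, delta) + a(eps) up to an
   additive constant.  As S(X, delta) is finite, both this constant and the
   change of scale disappear after division by log(1/eps). *)

Require Import Defs.
From HB Require Import structures.
From mathcomp Require Import all_boot all_order all_algebra finmap.
From mathcomp Require Import all_classical all_reals all_analysis.
From mathcomp Require Import zify lra.

Import Order.TTheory GRing.Theory Num.Theory.
Import numFieldNormedType.Exports.
Import metricType_numDomainType.

Local Open Scope classical_set_scope.
Local Open Scope ring_scope.

(** * Coding pairs of colours by one number *)

Lemma mixed_radix_lt {k l a b : nat} :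
  (a < k)%N -> (b < l)%N -> (a * l + b < k * l)%N.
Proof.
move=> ak bl; apply: (@leq_trans (a.+1 * l)); first by rewrite mulSn; lia.
by rewrite leq_mul2r ak orbT.
Qed.

Lemma mixed_radix_inj {l a b a' b' : nat} : (b < l)%N -> (b' < l)%N ->
  (a * l + b = a' * l + b')%N -> a = a' /\ b = b'.
Proof.
move=> bl b'l E; have l_gt0 : (0 < l)%N by lia.
have := congr1 (divn^~ l) E; have := congr1 (modn^~ l) E.
by rewrite !modnMDl !divnMDl // !modn_small // !divn_small // !addn0.
Qed.

(** * Covers by sets of small orbit diameter *)

Section OrbitCover.
Context {R : realType} {X : metricType R} (T : homeomorphism X).
Implicit Types (K : set X) (e : R) (m n k : nat).

Definition orbit_close m n e x y :=
  forall i, (m <= i < n)%N -> mdist (iter i T x) (iter i T y) <= e.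

(** A cover by [k] sets of diameter at most [e] along the times [[m, n)], encoded as a colouring:
    refining covers becomes arithmetic on colours, and no centres have to be carried along. *)
Definition coverable K e m n k := exists2 c : X -> nat,
  (forall x, K x -> (c x < k)%N) &
  (forall x y, K x -> K y -> c x = c y -> orbit_close m n e x y).

Lemma coverable_sub K L e m n k :
  K `<=` L -> coverable L e m n k -> coverable K e m n k.
Proof.
move=> KL [c ck cP]; exists c => [x /KL/ck//|x y /KL Kx /KL Ky].
exact: cP.
Qed.

(** The pair of colours, written in base [l], serves as colour for the concatenated time
    interval. *)
Lemma coverable_cat K e m n p k l :
  coverable K e m n k -> coverable K e n p l -> coverable K e m p (k * l).
Proof.
move=> [c ck cP] [d dl dP]; exists (fun x => c x * l + d x)%N => [x Kx|
  x y Kx Ky E].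
  exact: mixed_radix_lt (ck _ Kx) (dl _ Kx).
have [cE dE] := mixed_radix_inj (dl _ Kx) (dl _ Ky) E.
move=> i /andP[mi ip]; have [ni|ni] := ltnP i n.
  by apply: cP => //; rewrite mi.
by apply: dP => //; rewrite ni.
Qed.

Lemma coverable_shift K e m n k :
  coverable K e 0 m k -> coverable (iter n T @^-1` K) e n (n + m) k.
Proof.
move=> [c ck cP]; exists (c \o iter n T) => [x Kx|x y Kx Ky E i /andP[ni im]].
  exact: ck.
by rewrite -(subnK ni) !iterD; apply: cP => //; lia.
Qed.

Lemma coverable_exp e m n k : coverable setT e 0 1 k ->
  coverable setT e m (m + n) (k ^ n).
Proof.
move=> Xk; elim: n => [|n IHn].
  by exists (fun=> 0%N) => // x y _ _ _ i; rewrite addn0; lia.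
rewrite expnSr addnS -addn1; apply: coverable_cat IHn _.
exact: coverable_shift Xk.
Qed.

(** Each point of [K] gets the index of a chosen piece containing it, paired with its colour inside
    that piece. *)
Lemma coverable_bigcup (E : {fset X}) (L : X -> set X) K e m n k :
  (forall x, x \in E -> coverable (L x) e m n k) ->
  (forall y, K y -> exists2 x, x \in E & L x y) ->
  coverable K e m n (#|` E| * k).
Proof.
move=> LP KL.
have /choice[c cP] x : exists c : X -> nat, x \in E ->
    (forall y, L x y -> (c y < k)%N) /\
    (forall y z, L x y -> L x z -> c y = c z -> orbit_close m n e y z).
  by have [/LP[c ck cP]|xE] := boolP (x \in E); [exists c|exists (fun=> 0%N)].
have /choice[f fP] y : exists x, K y -> x \in E /\ L x y.
  by have [/KL[x xE Lxy]|nKy] := pselect (K y); [exists x|exists y].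
exists (fun y => index (f y) E * k + c (f y) y)%N => [y Ky|y z Ky Kz H].
  have [fE Lf] := fP _ Ky; apply: mixed_radix_lt; first by rewrite index_mem.
  exact: (cP _ fE).1.
have [fyE Lfy] := fP _ Ky; have [fzE Lfz] := fP _ Kz.
have [Hi Hc] := mixed_radix_inj ((cP _ fyE).1 _ Lfy) ((cP _ fzE).1 _ Lfz) H.
have fyz : f y = f z by rewrite -(nth_index y fyE) Hi nth_index.
rewrite -fyz in Lfz Hc; exact: (cP _ fyE).2.
Qed.

(** One representative is picked per colour; this direction keeps the scale [e]. *)
Lemma coverable_spanning K e n k : coverable K e 0 n k ->
  exists2 E : {fset X}, (#|` E| <= k)%N &
    forall x, K x -> exists2 y, y \in E & orbit_close 0 n e x y.
Proof.
move=> [c ck cP].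
have [[x0 Kx0]|K0] := pselect (K !=set0); last first.
  by exists fset0 => [|x Kx]; [rewrite cardfs0|case: K0; exists x].
have /choice[r rP] i : exists y, (exists2 x, K x & c x = i) -> K y /\ c y = i.
  have [[x Kx cx]|nK] := pselect (exists2 x, K x & c x = i); first by exists x.
  by exists x0.
exists (seq_fset tt [seq r i | i <- iota 0 k]) => [|x Kx].
  by rewrite size_seq_fset (leq_trans (size_undup _)) // size_map size_iota.
have [Kr cr] : K (r (c x)) /\ c (r (c x)) = c x by apply: rP; exists x.
exists (r (c x)); last exact: cP.
by rewrite seq_fsetE map_f // mem_iota /= ck.
Qed.

(** Points are coloured by a centre close to them; two points sharing a centre are [2 * e]-close by
    the triangle inequality. *)
Lemma spanning_coverable K (E : {fset X}) e n :
  (forall x, K x -> exists2 y, y \in E & orbit_close 0 n e x y) ->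
  coverable K (2 * e) 0 n #|` E|.
Proof.
move=> KE.
have /choice[f fP] y : exists x, K y -> x \in E /\ orbit_close 0 n e y x.
  by have [/KE[x xE Lxy]|nKy] := pselect (K y); [exists x|exists y].
exists (fun y => index (f y) E) => [x Kx|x y Kx Ky xy i ilt].
  by rewrite index_mem (fP _ Kx).1.
have [fxE xf] := fP _ Kx; have [fyE yf] := fP _ Ky.
have fxy : f x = f y by rewrite -(nth_index x fxE) xy nth_index.
rewrite (le_trans (metric_triangle _ (iter i T (f x)) _)) //.
rewrite mulr2n mulrDl mul1r lerD ?xf //.
by rewrite fxy metric_sym yf.
Qed.

Lemma continuous_iter n : continuous (iter n T).
Proof.
elim: n => [|n IHn] x; first exact: cvg_id.
apply: (@continuous_comp _ _ _ (iter n T) T); first exact: IHn.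
exact: homeo_continuous.
Qed.

Lemma continuous_homeo_iter a : continuous (homeo_iter T a).
Proof.
case: a => n /=; first exact: continuous_iter.
elim: n => [|n IHn] x; first exact: homeo_inv_continuous.
apply: (@continuous_comp _ _ _ (iter n.+1 (homeo_inv T)) (homeo_inv T)).
  exact: IHn.
exact: homeo_inv_continuous.
Qed.

(** Lets a two-sided window around the orbit point at time [n] be read as a stretch of the forward
    orbit. *)
Lemma homeo_iterD (a : int) n : 0 <= a + n%:Z ->
  homeo_iter T a \o iter n T = iter (absz (a + n%:Z)) T.
Proof.
case: a => m an; apply/funext => x /=; first by rewrite -iterD.
have mn : (m < n)%N by lia.
rewrite (_ : absz _ = n - m.+1)%N; last by lia.
rewrite -[in LHS](subnKC mn) iterD -iterS.
elim: m.+1 {mn an}(iter (n - m.+1) T x) => // j IHj y.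
by rewrite iterSr [iter j.+1 T y]/= homeo_funK IHj.
Qed.

Lemma mdist_continuous2 (Y : topologicalType) (f g : Y -> X) (y : Y) e :
  {for y, continuous f} -> {for y, continuous g} ->
  mdist (f y) (g y) < e -> \forall z \near y, mdist (f z) (g z) < e.
Proof.
move=> fc gc fge; pose d := (e - mdist (f y) (g y)) / 2.
have d_gt0 : 0 < d by rewrite divr_gt0 // subr_gt0.
near=> z.
have fz : mdist (f y) (f z) < d by near: z; exact: cvgr_dist_lt.
have gz : mdist (g y) (g z) < d by near: z; exact: cvgr_dist_lt.
have := metric_triangle (f z) (f y) (g z).
have := metric_triangle (f y) (g y) (g z).
rewrite [mdist (f z) (f y)]metric_sym; rewrite /d in fz gz; lra.
Unshelve. all: by end_near. Qed.

Lemma mdist_continuous2_gt (Y : topologicalType) (f g : Y -> X) (y : Y) e :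
  {for y, continuous f} -> {for y, continuous g} ->
  e < mdist (f y) (g y) -> \forall z \near y, e < mdist (f z) (g z).
Proof.
move=> fc gc fge; pose d := (mdist (f y) (g y) - e) / 2.
have d_gt0 : 0 < d by rewrite divr_gt0 // subr_gt0.
near=> z.
have fz : mdist (f y) (f z) < d by near: z; exact: cvgr_dist_lt.
have gz : mdist (g y) (g z) < d by near: z; exact: cvgr_dist_lt.
have := metric_triangle (f y) (f z) (g y).
have := metric_triangle (f z) (g z) (g y).
rewrite [mdist (g z) (g y)]metric_sym; rewrite /d in fz gz; lra.
Unshelve. all: by end_near. Qed.

(** * Consequences of compactness *)

Context (compactX : compact [set: X]).

Lemma compact_finite_net e : 0 < e ->
  exists s : seq X, forall x, exists2 y, y \in s & mdist x y <= e.
Proof.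
move=> e_gt0.
(* [compact_cover] requires a pointed space, whereas near-covering along the
   finite subsets directed by inclusion does not. *)
pose F : set_system (seq X) :=
  [set A | exists s0 : seq X, forall s : seq X, {subset s0 <= s} -> A s].
have FF : Filter F.
  split; first by exists [::].
    move=> A B [s As] [t Bt]; exists (s ++ t) => r str; split.
      by apply: As => x xs; apply: str; rewrite mem_cat xs.
    by apply: Bt => x xt; apply: str; rewrite mem_cat xt orbT.
  by move=> A B AB [s As]; exists s => r /As/AB.
have [|s] := (iffLR (compact_near_coveringP _) compactX) _ F
    (fun s x => exists2 y, y \in s & mdist x y <= e) FF.
  move=> x _; exists ([set y | mdist x y < e], [set s | x \in s]) => /=.
    split; last by exists [:: x] => s; apply; rewrite mem_head.
    by rewrite -ballEmdist; exact: nbhsx_ballx.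
  by move=> [y s] [/= xy xs]; exists x => //; rewrite metric_sym ltW.
move=> sP; exists s => x; exact: (sP s (fun _ => id) x I).
Qed.

Lemma compact_coverable e : 0 < e ->
  exists2 k, (0 < k)%N & coverable setT e 0 1 k.
Proof.
move=> e_gt0; have [|s sP] := @compact_finite_net (e / 2).
  by rewrite divr_gt0.
(* The successor keeps the number of colours positive even when [X] is empty. *)
exists (#|` (seq_fset tt s)|.+1) => //.
have : coverable setT e 0 1 #|` (seq_fset tt s)|.
  rewrite (_ : e = 2 * (e / 2)); last by rewrite mulrC divfK.
  apply: spanning_coverable => x _; have [y ys xy] := sP x.
  by exists y; [rewrite seq_fsetE|case].
by case=> c ck cP; exists c => // x Kx; rewrite ltnW // ltnS ck.
Qed.

(** Keeps the supremum in [dist_on] away from its default value on unbounded sets. The bound is the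
    sum of all distances within a finite [1]-net, plus [1] for each endpoint. *)
Lemma mdist_bounded : exists M, forall x y : X, mdist x y <= M.
Proof.
have [s sP] := compact_finite_net _ ltr01.
pose B := \sum_(y <- s) \sum_(z <- s) mdist y z.
exists (2 + B) => x x'; have [y ys xy] := sP x; have [z zs xz] := sP x'.
have yzB : mdist y z <= B.
  rewrite /B (big_rem y) //= (big_rem z) //= -addrA lerDl.
  by rewrite addr_ge0 // sumr_ge0 // => *;
    rewrite ?sumr_ge0 // => *; exact: mdist_ge0.
have := metric_triangle x y x'; have := metric_triangle y z x'.
rewrite [mdist z x']metric_sym; lra.
Qed.

Lemma dist_on_le (Omega : set int) x y e : 0 <= e ->
  dist_on T Omega x y <= e <->
  forall a, Omega a -> mdist (homeo_iter T a x) (homeo_iter T a y) <= e.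
Proof.
move=> e_ge0; have [M MP] := mdist_bounded; split=> [xye a Oa|xye].
  apply: le_trans xye; apply: ub_le_sup; last by exists a.
  by exists M => _ [b _ <-].
have [[a Oa]|O0] := pselect (Omega !=set0).
  apply: ge_sup.
    by exists (mdist (homeo_iter T a x) (homeo_iter T a y)); exists a.
  by move=> _ [b Ob <-]; exact: xye.
(* For empty [Omega], as in [dist_upto T 0], the default value [0] of [sup] is still at most [e]. *)
rewrite /dist_on (_ : Omega = set0); first by rewrite image_set0 sup0.
by rewrite -subset0 => a Oa; case: O0; exists a.
Qed.

Lemma dist_upto_le n x y e : 0 <= e ->
  dist_upto T n x y <= e <-> orbit_close 0 n e x y.
Proof.
move=> e_ge0; rewrite dist_on_le //; split=> xye.
  by move=> i ilt; apply: (xye (Posz i)) => /=; lia.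
by case=> i ilt; [apply: xye; move: ilt => /=; lia|].
Qed.

End OrbitCover.

(** * Extended reals, upper and lower limits *)

Section ExtendedReals.
Context {R : realType}.
Implicit Types (x y : \bar R) (r : R).

Lemma lte_div_fin x y r : 0 < r -> (x / r%:E < y)%E = (x < y * r%:E)%E.
Proof. by move=> r_gt0; rewrite inver gt_eqF // lte_pdivrMr. Qed.

Lemma lee_div_fin x y r : 0 < r -> (x / r%:E <= y)%E = (x <= y * r%:E)%E.
Proof. by move=> r_gt0; rewrite inver gt_eqF // lee_pdivrMr. Qed.

(** Reduces comparisons of upper and lower limits to real thresholds. *)
Lemma lee_real_ub x y : (forall r, y < r%:E -> x <= r%:E)%E -> (x <= y)%E.
Proof.
case: y => [y| |] xy; last 2 first.
- exact: leey.
- case: x xy => [x| |] xy //; last by have := xy 0%R (ltNyr _).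
  by have := xy (x - 1)%R (ltNyr _); rewrite lee_fin => ?; exfalso; lra.
apply/lee_addgt0Pr => e e_gt0; rewrite -EFinD xy // lte_fin.
by rewrite ltrDl.
Qed.

Lemma lne_lt_fin x r : (lne x < r%:E)%E -> (x < (expR r)%:E)%E.
Proof.
case: x => [x| |] //=; last by rewrite ltNyr => _; rewrite ltNyr.
case: ifPn => [x_le0 _|]; first
  by rewrite lte_fin (le_lt_trans x_le0) ?expR_gt0.
by rewrite -ltNge !lte_fin => x_gt0; rewrite -ltr_expR lnK.
Qed.

Lemma lne_le_fin x r : (x <= (expR r)%:E)%E -> (lne x <= r%:E)%E.
Proof.
case: x => [x| |] //=; last by rewrite !leNye.
case: ifPn => [_ _|]; first by rewrite leNye.
by rewrite -ltNge !lee_fin => x_gt0 xr; rewrite -ler_expR lnK.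
Qed.

Lemma le_lne x y : (x <= y)%E -> (lne x <= lne y)%E.
Proof.
move=> xy; have [x_le0|x_gt0] := leP x 0%E; first by rewrite le0_lneNy ?leNye.
by rewrite lee_lne // !in_itv /= leey ltW // (lt_le_trans x_gt0).
Qed.

Section Limsup.
Context {U : choiceType} {T : filteredType U} (F : set_system T).
Implicit Types (f g : T -> \bar R).

Lemma limf_esup_lt f x : Filter F -> (limf_esup f F < x)%E ->
  \forall t \near F, (f t < x)%E.
Proof.
move=> FF; rewrite limf_esupE => /ereal_inf_lt[_ [V FV <-]] fVx.
apply: filterS FV => t Vt; apply: le_lt_trans fVx.
by apply: ereal_sup_ubound; exists t.
Qed.

Lemma limf_esup_le f x : (\forall t \near F, (f t <= x)%E) ->
  (limf_esup f F <= x)%E.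
Proof.
move=> fx; rewrite limf_esupE; apply: ge_ereal_inf.
exists (ereal_sup (f @` [set t | f t <= x]%E)).
  by exists [set t | f t <= x]%E.
by apply: ge_ereal_sup => _ [t ft <-].
Qed.

Lemma limf_einf_lt f x V : (limf_einf f F < x)%E -> F V ->
  exists2 t, V t & (f t < x)%E.
Proof.
rewrite limf_einfE => fx FV.
have /ereal_inf_lt[_ [t Vt <-]] : (ereal_inf (f @` V) < x)%E.
  by apply: le_lt_trans fx; apply: ereal_sup_ubound; exists V.
by exists t.
Qed.

Lemma limf_einf_le f x : (forall V, F V -> exists2 t, V t & (f t <= x)%E) ->
  (limf_einf f F <= x)%E.
Proof.
move=> fx; rewrite limf_einfE; apply: ge_ereal_sup => _ [V FV <-].
have [t Vt ft] := fx V FV.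
by apply: ge_ereal_inf; exists (f t) => //; exists t.
Qed.

Lemma le_limf_esup f g : Filter F -> (\forall t \near F, (f t <= g t)%E) ->
  (limf_esup f F <= limf_esup g F)%E.
Proof.
move=> FF fg; apply: lee_real_ub => r /(limf_esup_lt _ _ FF) gr.
apply: limf_esup_le; apply: filterS2 fg gr => t fgt gtr.
exact: le_trans fgt (ltW gtr).
Qed.

Lemma le_limf_einf f g : Filter F -> (\forall t \near F, (f t <= g t)%E) ->
  (limf_einf f F <= limf_einf g F)%E.
Proof.
move=> FF fg; apply: lee_real_ub => r gr; apply: limf_einf_le => V FV.
have [t [Vt fgt] gtr] := limf_einf_lt _ _ _ gr (filterI FV fg).
by exists t => //; exact: le_trans fgt (ltW gtr).
Qed.

End Limsup.

Lemma near0_right (P : R -> Prop) :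
  (\forall e \near 0^'+, P e) <-> exists2 d, 0 < d & forall e, 0 < e < d -> P e.
Proof.
split=> [[d /= d_gt0 dP]|[d d_gt0 dP]].
  exists d => // e /andP[e_gt0 ed]; apply: dP => //=.
  by rewrite sub0r normrN gtr0_norm.
near=> e; apply: dP; apply/andP; split; near: e.
  exact: nbhs_right_gt.
exact: nbhs_right_lt.
Unshelve. all: by end_near. Qed.

End ExtendedReals.

(** * Entropy in terms of finite spanning sets *)

Section Entropy.
Context {R : realType} {X : metricType R} (T : homeomorphism X).
Context (compactX : compact [set: X]).
Implicit Types (K : set X) (E : {fset X}) (e r c delta : R) (m n k N : nat).

Definition spans K e n E :=
  forall x, K x -> exists2 y, y \in E & orbit_close T 0 n e x y.

Lemma spanning_set_upto K e n E : 0 <= e ->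
  spanning_set K (dist_upto T n) e [set` E] <-> spans K e n E.
Proof.
move=> e_ge0; split=> KE x /KE[y yE xy]; exists y => //.
  exact/(dist_upto_le T compactX).
exact/(dist_upto_le T compactX).
Qed.

Lemma spanning_number_lt K e n (r : R) : 0 <= e ->
  (spanning_number K (dist_upto T n) e < r%:E)%E ->
  exists2 E, #|` E|%:R < r & spans K e n E.
Proof.
move=> e_ge0 /ereal_inf_lt[_ [E /= /(spanning_set_upto _ _ _ _ e_ge0) KE <-]].
by rewrite lte_fin; exists E.
Qed.

Lemma spanning_number_le K e n E : 0 <= e -> spans K e n E ->
  (spanning_number K (dist_upto T n) e <= #|` E|%:R%:E)%E.
Proof.
move=> e_ge0 KE; apply: ge_ereal_inf; exists #|` E|%:R%:E => //.
by exists E => //=; apply/spanning_set_upto.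
Qed.

Lemma entropy_lt_spans K e c : 0 <= e ->
  (entropy_at_scale T K e < c%:E)%E ->
  \forall n \near \oo, exists2 E, #|` E|%:R < expR (c * n%:R) & spans K e n E.
Proof.
move=> e_ge0 /(limf_esup_lt _ _ _ _) Kc; near=> n.
apply: spanning_number_lt => //; apply: lne_lt_fin.
have n_gt0 : (0 < n)%N by near: n; exact: nbhs_infty_gt.
by rewrite EFinM -lte_div_fin ?ltr0n //; near: n.
Unshelve. all: by end_near. Qed.

Lemma entropy_le_spans K e c : 0 <= e ->
  (\forall n \near \oo,
    exists2 E, #|` E|%:R <= expR (c * n%:R) & spans K e n E) ->
  (entropy_at_scale T K e <= c%:E)%E.
Proof.
move=> e_ge0 Kc; apply: limf_esup_le; near=> n.
have n_gt0 : (0 < n)%N by near: n; exact: nbhs_infty_gt.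
rewrite lee_div_fin ?ltr0n // -EFinM; apply: lne_le_fin.
have [E Ec KE] : exists2 E, #|` E|%:R <= expR (c * n%:R) & spans K e n E.
  by near: n.
by rewrite (le_trans (spanning_number_le _ _ _ _ e_ge0 KE)) // lee_fin.
Unshelve. all: by end_near. Qed.

Lemma le_entropy K L e : K `<=` L ->
  (entropy_at_scale T K e <= entropy_at_scale T L e)%E.
Proof.
move=> KL; apply: le_limf_esup; near=> n.
have n_gt0 : (0 < n)%N by near: n; exact: nbhs_infty_gt.
rewrite inver gt_eqF ?ltr0n // lee_pmul2r ?lte_fin ?invr_gt0 ?ltr0n //.
apply: le_lne; apply: ereal_inf_le_tmp => _ [E LE <-].
by exists E => // x /KL; exact: LE.
Unshelve. all: by end_near. Qed.

Lemma entropy_ge0 K e : 0 <= e -> K !=set0 ->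
  (0 <= entropy_at_scale T K e)%E.
Proof.
move=> e_ge0 [x Kx]; apply: limf_esup_ge0 => [|n].
  by case=> N _ /(_ N) /=; exact.
rewrite mule_ge0 ?inve_ge0 ?lee_fin // lne_ge0.
apply: le_ereal_inf_tmp => _ [E KE <-]; rewrite lee_fin ler1n.
have [y yE _] := KE x Kx.
by rewrite cardfs_gt0; apply/fset0Pn; exists y.
Qed.

(** A one-step cover by [k] sets refines to one by [k ^ n] sets for [n] steps, so the entropy is at
    most [ln k]. *)
Lemma entropy_setT_fin e : 0 < e ->
  exists r, (entropy_at_scale T setT e <= r%:E)%E.
Proof.
move=> e_gt0; have [k k_gt0 Xk] := compact_coverable T compactX _ e_gt0.
exists (ln k%:R); apply: entropy_le_spans; first exact: ltW.
near=> n; have [E Ek XE] := coverable_spanning _ _ _ _ _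
  (coverable_exp T e 0 n k Xk).
exists E => //; rewrite expRM_natr lnK ?posrE ?ltr0n //.
by rewrite -natrX ler_nat.
Unshelve. all: by end_near. Qed.

(** * Bowen's covering argument *)

Definition window_ball N delta u := [set w | forall a : int, (absz a <= N)%N ->
  mdist (homeo_iter T a u) (homeo_iter T a w) <= delta].

(** Compactness is used twice: over the centres [u], to make [N] uniform, and, near a fixed centre
    [x], over the points [w], to pass from the full ball around [x] to window balls around nearby
    centres. *)
Lemma window_ball_cover delta e c : 0 <= delta -> 0 < e ->
  (forall x, entropy_at_scale T (closed_ball_on T setT x delta) e < c%:E)%E ->
  exists N, forall u, exists m k, [/\ (0 < m <= N)%N,
    k%:R <= expR (c * m%:R) &
    coverable T (window_ball N delta u) (4 * e) 0 m k].
Proof.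
move=> delta_ge0 e_gt0 Bc.
pose P N u := exists m k, [/\ (0 < m <= N)%N,
    k%:R <= expR (c * m%:R) &
    coverable T (window_ball N delta u) (4 * e) 0 m k].
suff [N _ NP] : \forall N \near \oo, [set: X] `<=` P N.
  by exists N => u; exact: (NP N (leqnn N) u I).
apply: (iffLR (compact_near_coveringP _) compactX) => x _.
(* One good time [m] for [x]; it stays fixed for all centres near [x]. *)
have [m [m_gt0 [E Em BE]]] : exists m, (0 < m)%N /\
    exists2 E, #|` E|%:R < expR (c * m%:R) &
      spans (closed_ball_on T setT x delta) e m E.
  have [N _ NE] := entropy_lt_spans _ _ _ (ltW e_gt0) (Bc x).
  by exists N.+1; split => //; apply: NE => /=.
pose Q (uN : X * nat) w := window_ball uN.2 delta uN.1 w ->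
  exists2 y, y \in E & orbit_close T 0 m (2 * e) w y.
have : \forall uN \near filter_prod (nbhs x) \oo, [set: X] `<=` Q uN.
  have /(_ _ (filter_prod (nbhs x) \oo) Q _) :=
    iffLR (compact_near_coveringP _) compactX.
  apply => w _.
  (* If [w] lies in the full ball, some [y] in [E] is [e]-close to it, and by continuity
     [2 * e]-close to all points near [w]. *)
  have [wB|] := pselect (forall a,
      mdist (homeo_iter T a x) (homeo_iter T a w) <= delta).
    have [|y yE wy] := BE w.
      by apply/(dist_on_le T compactX).
    have : \forall w' \near w, forall i : 'I_m,
        mdist (iter i T w') (iter i T y) < 2 * e.
      apply: filter_forall => i; apply: mdist_continuous2.
      - exact: continuous_iter.
      - exact: cst_continuous.
      - by apply: (@le_lt_trans _ _ e); [|lra]; apply: wy => /=.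
    move=> wE; exists ([set w' | forall i : 'I_m,
        mdist (iter i T w') (iter i T y) < 2 * e], setT) => /=.
      by split => //; exact: filterT.
    move=> [w' uN] [/= w'E _] _; exists y => // i /andP[_ im].
    exact: ltW (w'E (Ordinal im)).
  (* Otherwise some time [a] separates [w] from [x] by more than [delta]. This persists near
     [(x, w)], so once [N >= |a|] the points near [w] are outside the window balls of centres near
     [x]. *)
  move=> /existsNP[a /negP]; rewrite -ltNge => xw.
  have xw' : \forall z \near (x, w),
      delta < mdist (homeo_iter T a z.1) (homeo_iter T a z.2).
    apply: (mdist_continuous2_gt _ (fun z => homeo_iter T a z.1)
      (fun z => homeo_iter T a z.2) (x, w)) => //.
      apply: continuous_comp; first exact: cvg_fst.
      exact: continuous_homeo_iter.
    apply: continuous_comp; first exact: cvg_snd.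
    exact: continuous_homeo_iter.
  case: xw' => -[U V] [/= xU wV] UV.
  exists (V, U `*` [set N | absz a <= N]%N) => /=.
    split => //; exists (U, [set N | absz a <= N]%N) => //=.
    by split => //; exact: nbhs_infty_ge.
  move=> [w' [u N]] [/= Vw' [/= Uu aN]] /(_ a aN).
  by rewrite leNgt (UV (u, w')).
move=> [[U V] [/= xU V_oo] UV].
exists (U, V `&` [set N | m <= N]%N) => /=.
  by split=> //; apply: filterI => //; exact: nbhs_infty_ge.
move=> [u N] [/= Uu [VN mN]].
exists m, #|` E|; split; [by rewrite m_gt0|exact: ltW|].
(* One doubling came from continuity, the other comes from passing from centres to diameters. *)
rewrite (_ : 4 * e = 2 * (2 * e)); last by rewrite mulrA -natrM.
by apply: spanning_coverable => w; exact: (UV (u, N)).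
Unshelve. all: by end_near. Qed.

(** Windows are concatenated along the orbit of [x]. The first [N] times and the at most [N] last
    ones, where a two-sided window would leave [[0, n)], are covered crudely by powers of [k0];
    hence the factor with exponent [N + N]. *)
Lemma dynamical_ball_cover delta e c N k0 n x : 0 <= c -> (0 < k0)%N ->
  coverable T setT e 0 1 k0 ->
  (forall u, exists m k, [/\ (0 < m <= N)%N,
    k%:R <= expR (c * m%:R) & coverable T (window_ball N delta u) e 0 m k]) ->
  exists2 k, k%:R <= k0%:R ^+ (N + N) * expR (c * n%:R) &
    coverable T (orbit_close T 0 n delta x) e 0 n k.
Proof.
move=> c_ge0 k0_gt0 Xk0 wP; set K := orbit_close T 0 n delta x.
have k0X i j : (i <= j)%N -> k0%:R ^+ i <= k0%:R ^+ j * 1 :> R.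
  by move=> ij; rewrite mulr1 ler_weXn2l ?ler1n.
have Xexp i j : coverable T K e i (i + j) (k0 ^ j).
  by apply: coverable_sub (coverable_exp T e i j k0 Xk0).
have expc i : 1 <= expR (c * i%:R) by rewrite -expR0 ler_expR mulr_ge0.
(* Strong induction on the remaining time [r], started at a time [t] with [N] past steps
   available. *)
have tail : forall r t : nat, (N <= t)%N -> (t + r)%N = n ->
    exists2 k, k%:R <= k0%:R ^+ N * expR (c * r%:R) & coverable T K e t n k.
  elim/ltn_ind => r IHr t Nt tr.
  have [rN|Nr] := leqP r N.
    exists (k0 ^ r)%N; last by rewrite -tr.
    rewrite natrX (le_trans (k0X _ _ rN)) // ler_pM2l ?exprn_gt0 ?ltr0n //.
  have [m [k [/andP[m_gt0 mN] km kP]]] := wP (iter t T x).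
  have [|||l lr lP] := IHr (r - m)%N _ (t + m)%N; [lia..|].
  exists (k * l)%N.
    rewrite natrM.
    rewrite (_ : expR _ = expR (c * m%:R) * expR (c * (r - m)%:R)); last first.
      by rewrite -expRD -mulrDr -natrD subnKC // ltnW // (leq_ltn_trans mN).
    by rewrite mulrCA ler_pM.
  apply: coverable_cat lP.
  (* As [N <= t] and [t + N < n], being [delta]-close on [[0, n)] puts the time-[t] image in the
     window ball around [iter t T x]. *)
  apply: coverable_sub (coverable_shift _ _ _ _ t _ kP).
  move=> w Kw a aN; have at_ge0 : 0 <= a + t%:Z by lia.
  have := homeo_iterD T a t at_ge0.
  move=> /[dup] /(congr1 (@^~ x)) /= -> /(congr1 (@^~ w)) /= ->.
  by apply: Kw; lia.
have [nN|Nn] := leqP n N.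
  exists (k0 ^ n)%N; last exact: Xexp.
  rewrite natrX (le_trans (k0X n (N + N)%N _)) //; first by lia.
  by rewrite ler_pM2l ?exprn_gt0 ?ltr0n.
have [||k kn kP] := tail (n - N)%N N; [lia..|].
exists (k0 ^ N * k)%N; last exact: coverable_cat (Xexp 0%N N) kP.
rewrite natrM natrX exprD -mulrA ler_pM2l ?exprn_gt0 ?ltr0n //.
rewrite (le_trans kn) // ler_pM2l ?exprn_gt0 ?ltr0n //.
by rewrite ler_expR ler_wpM2l // ler_nat leq_subr.
Qed.

(* Bowen's inequality at a fixed scale: [X] is covered by the dynamical
   [delta]-balls around a spanning set, and each of them by few [4e]-classes. *)
Lemma entropy_setT_le delta e c H : 0 <= delta -> 0 < e -> 0 <= c ->
  (forall x, entropy_at_scale T (closed_ball_on T setT x delta) e < c%:E)%E ->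
  (entropy_at_scale T setT delta < H%:E)%E ->
  (entropy_at_scale T setT (4 * e) <= (H + 1 + c)%:E)%E.
Proof.
move=> delta_ge0 e_gt0 c_ge0 Bc XH.
have e4_gt0 : 0 < 4 * e by rewrite mulr_gt0.
have [N NP] := window_ball_cover _ _ _ delta_ge0 e_gt0 Bc.
have [k0 k0_gt0 Xk0] := compact_coverable T compactX _ e4_gt0.
apply: entropy_le_spans; first exact: ltW.
near=> n.
have [E En XE] : exists2 E, #|` E|%:R < expR (H * n%:R) & spans setT delta n E.
  by near: n; exact: entropy_lt_spans.
(* This bound does not depend on the centre, so its truncation is a common number of colours for all
   dynamical balls. *)
pose b := k0%:R ^+ (N + N) * expR (c * n%:R).
have b_ge0 : 0 <= b by rewrite mulr_ge0 ?expR_ge0 ?exprn_ge0.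
have [|F Fb FP] := coverable_spanning T setT (4 * e) n (#|` E| * Num.truncn b).
  apply: (@coverable_bigcup _ _ T E (fun x => orbit_close T 0 n delta x)).
    move=> x _; have [k kb [f fk fP]] :=
      dynamical_ball_cover _ _ _ _ _ n x c_ge0 k0_gt0 Xk0 NP.
    exists f => // y xy; rewrite (leq_trans (fk _ xy)) //.
    by rewrite truncn_ge_nat.
  move=> y _; have [x xE yx] := XE y I; exists x => // i ilt.
  by rewrite metric_sym yx.
exists F => //.
rewrite (le_trans (_ : _ <= #|` E|%:R * b)) //.
  rewrite (@le_trans _ _ (#|` E| * Num.truncn b)%:R) ?ler_nat //.
  by rewrite natrM ler_wpM2l // -truncn_ge_nat.
rewrite 2!mulrDl mul1r 2!expRD /b mulrA ler_pM2r ?expR_gt0 //.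
apply: ler_pM; rewrite ?exprn_ge0 ?(ltW En) //.
(* The summand [1] in the rate supplies a factor [expR n >= 1 + n], which eventually exceeds the
   constant power of [k0]. *)
apply: le_trans (expR_ge1Dx _); rewrite -lerBlDl.
near: n; exact: nbhs_infty_ger.
Unshelve. all: by end_near. Qed.

End Entropy.

(** * Comparing the scales [e] and [4 * e] *)

Section ScaleComparison.
Context {R : realType}.
Implicit Types (e r H : R).

Lemma ln_inv_quadruple_slack H r eta : 0 < eta ->
  exists2 d, 0 < d & forall e, 0 < e < d ->
    [/\ 0 < ln (1 / e), 0 < ln (1 / (4 * e)) &
        H + r * ln (1 / e) <= (r + eta) * ln (1 / (4 * e))].
Proof.
(* With [L = ln (1 / e)] the inequality reads [H + (r + eta) * ln 4 <= eta * L]; the extra [ln 4] in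
   [B] makes [L - ln 4] positive. *)
move=> eta_gt0; pose B := `|H + (r + eta) * ln 4| / eta + ln 4.
have ln4_ge0 : 0 <= ln 4 :> R by apply: ln_ge0; lra.
have B_ge : ln 4 <= B by rewrite lerDr divr_ge0 // ltW.
exists (expR (- B)); first exact: expR_gt0.
move=> e /andP[e_gt0 ed].
have LB : B < ln (1 / e).
  by rewrite div1r lnV ?posrE // ltrNr -ltr_expR lnK ?posrE.
have L4 : ln (1 / (4 * e)) = ln (1 / e) - ln 4.
  rewrite !div1r invfM mulrC ln_div ?posrE ?invr_gt0 //; lra.
split; rewrite ?L4; [lra|lra|].
have : `|H + (r + eta) * ln 4| <= eta * (ln (1 / e)).
  by rewrite [leRHS]mulrC -ler_pdivrMr // ltW // (le_lt_trans _ LB) // lerDl.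
have := ler_norm (H + (r + eta) * ln 4).
nra.
Qed.

(** Replacing [e] by [4 * e] changes [ln (1 / e)] by a constant only. This constant and [H] cost an
    arbitrarily small [eta] after division. *)
Lemma limf_scale_quadruple (S A : R -> \bar R) H :
  (forall e, 0 < e -> (A e <= S e)%E) ->
  (forall e c, 0 < e -> (A e < c%:E)%E -> (S (4 * e)%R <= (H + c)%:E)%E) ->
  limf_esup (fun e => S e / (ln (1 / e))%:E)%E 0^'+ =
    limf_esup (fun e => A e / (ln (1 / e))%:E)%E 0^'+ /\
  limf_einf (fun e => S e / (ln (1 / e))%:E)%E 0^'+ =
    limf_einf (fun e => A e / (ln (1 / e))%:E)%E 0^'+.
Proof.
move=> AS SA.
have AS_near : \forall e \near 0^'+,
    (A e / (ln (1 / e))%:E <= S e / (ln (1 / e))%:E)%E.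
  have [d d_gt0 dP] := ln_inv_quadruple_slack 0 0 1 ltr01.
  apply/near0_right; exists d => // e ed; have [L_gt0 _ _] := dP e ed.
  rewrite inver gt_eqF // lee_pmul2r ?lte_fin ?invr_gt0 // AS //.
  by case/andP: ed.
have SA_step r eta : 0 < eta -> exists2 d, 0 < d & forall e, 0 < e < d ->
    (A e / (ln (1 / e))%:E < r%:E)%E ->
    (S (4 * e)%R / (ln (1 / (4 * e)))%:E <= (r + eta)%:E)%E.
  move=> eta_gt0; have [d d_gt0 dP] := ln_inv_quadruple_slack H r eta eta_gt0.
  exists d => // e ed; have [L_gt0 L4_gt0 LL] := dP e ed.
  rewrite lte_div_fin // lee_div_fin // -!EFinM.
  have /andP[e_gt0 _] := ed => /(SA _ _ e_gt0) /le_trans; apply.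
  by rewrite lee_fin.
split; apply/eqP; rewrite eq_le; apply/andP; split.
- apply: lee_real_ub => r /(limf_esup_lt _ _ _ _) Ar.
  apply/lee_addgt0Pr => eta eta_gt0; rewrite -EFinD.
  have [d1 d1_gt0 d1P] := SA_step r eta eta_gt0.
  have /near0_right[d2 d2_gt0 d2P] := Ar.
  apply: limf_esup_le; apply/near0_right.
  exists (4 * Num.min d1 d2); first by rewrite mulr_gt0 // lt_min d1_gt0.
  move=> e /andP[e_gt0 ed]; rewrite (_ : e = 4 * (e / 4)); last by lra.
  have : e / 4 < Num.min d1 d2 by rewrite ltr_pdivrMr // mulrC.
  rewrite lt_min => /andP[ed1 ed2].
  by apply: d1P; [|apply: d2P]; rewrite divr_gt0.
- exact: le_limf_esup.
- apply: lee_real_ub => r Ar.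
  apply/lee_addgt0Pr => eta eta_gt0; rewrite -EFinD.
  have [d1 d1_gt0 d1P] := SA_step r eta eta_gt0.
  apply: limf_einf_le => V /near0_right[d2 d2_gt0 d2P].
  (* The bound [d2 / 4] ensures that [4 * e], the scale at which [S] is evaluated, falls in [V]. *)
  pose W := [set e : R | 0 < e < Num.min d1 (d2 / 4)].
  have W_near : \forall e \near 0^'+, W e.
    by apply/near0_right; exists (Num.min d1 (d2 / 4));
      rewrite ?lt_min ?d1_gt0 ?divr_gt0.
  have [e /andP[e_gt0 /=]] := limf_einf_lt _ _ _ W Ar W_near.
  rewrite lt_min ltr_pdivlMr // => /andP[ed1 ed2] Ae.
  by exists (4 * e); [apply: d2P|apply: d1P]; rewrite ?mulr_gt0 ?e_gt0 // mulrC.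
- exact: le_limf_einf.
Qed.

End ScaleComparison.

Theorem theorem1p1 (R : realType) (X : metricType R)
  (compactX : compact [set: X]) (T : homeomorphism X)
  (delta : R) (delta_gt0 : 0 < delta) :
  upper_mdim T =
    limf_esup (fun eps : R =>
      ereal_sup [set entropy_at_scale T
                       (closed_ball_on T [set: int] x delta) eps
                | x in [set: X]]
      / (ln (1 / eps))%:E)%E 0^'+
  /\
  lower_mdim T =
    limf_einf (fun eps : R =>
      ereal_sup [set entropy_at_scale T
                       (closed_ball_on T [set: int] x delta) eps
                | x in [set: X]]
      / (ln (1 / eps))%:E)%E 0^'+.
Proof.
have [h Xh] := entropy_setT_fin T compactX _ delta_gt0.
(* One [1] makes the bound [h] on the entropy at scale [delta] strict; the other is the loss in
   [entropy_setT_le]. *)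
apply: (limf_scale_quadruple _ _ (h + 1 + 1)) => [e e_gt0|e c e_gt0 Ac].
  by apply: ge_ereal_sup => _ [x _ <-]; exact: le_entropy.
have Bc x : (entropy_at_scale T (closed_ball_on T setT x delta) e < c%:E)%E.
  by apply: le_lt_trans Ac; apply: ereal_sup_ubound; exists x.
(* For empty [X] the supremum is [-oo] and [c] may be negative, but the empty set spans. *)
have [[x _]|X0] := pselect ([set: X] !=set0); last first.
  apply: (entropy_le_spans T compactX); first by rewrite mulr_ge0 ?ltW.
  apply: nearW => n; exists fset0; first by rewrite cardfs0 expR_ge0.
  by move=> x; case: X0; exists x.
apply: (entropy_setT_le T compactX delta) => //; try exact: ltW.
  (* Here [c >= 0], since the ball around [x] contains [x] and so has nonnegative entropy. *)
  rewrite -lee_fin (le_trans _ (ltW (Bc x))) //.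
  apply: entropy_ge0; first exact: ltW.
  exists x; apply/(dist_on_le T compactX); rewrite ?ltW // => a _.
  by rewrite mdistxx ltW.
by rewrite (le_lt_trans Xh) // lte_fin ltrDl.
Qed.
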